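(* Let $f=\sum_{i=1}^mf_i$, where each $f_i:\mathbb{R}^n\to\mathbb{R}\cup\{\infty\}$ is proper and closed. Suppose that each $f_i$ is LMI-representable, i.e., there exist $d_i\ge1$ and matrices $\{A^i_{00},A^i_0,A^i_1,\dots,A^i_n\}\subset\mathcal{S}^{d_i}$ such that $$\operatorname{epi}f_i=\Big\{(x,t)\in\mathbb{R}^n\times\mathbb{R}:\ A^i_{00}+\sum_{j=1}^nA^i_jx_j+A^i_0t\succeq0\Big\}.$$ Suppose in addition that there exist $x^s\in\mathbb{R}^n$ and $s^s\in\mathbb{R}^m$ such that for $i=1,\dots,m$, $$A^i_{00}+\sum_{j=1}^nA^i_jx^s_j+A^i_0s^s_i\succ0.$$ If $\bar x\in\operatorname{dom}\partial f$ satisfies $0\in\operatorname{ri}\partial f(\bar x)$, then $f$ satisfies the KL property at $\bar x$ with exponent $\frac12$.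
   Context: $\mathcal{S}^d$ is the space of $d\times d$ real symmetric matrices; $\succeq0$ (resp. $\succ0$) means positive semidefinite (resp. definite). $\operatorname{epi}h:=\{(x,t):h(x)\le t\}$. $\operatorname{ri}$ is relative interior. A function $h:\mathbb{X}\to\mathbb{R}\cup\{\infty\}$ is proper if $\operatorname{dom}h:=\{x:h(x)<\infty\}\neq\emptyset$, and closed if it is lower semicontinuous. The regular subdifferential of a proper $h$ at $x\in\operatorname{dom}h$ is $\hat\partial h(x)=\{\zeta:\liminf_{z\to x,z\ne x}\frac{h(z)-h(x)-\langle\zeta,z-x\rangle}{\|z-x\|}\ge0\}$; the (limiting) subdifferential is $\partial h(x)=\{\zeta:\exists\,x^k\to x,\ h(x^k)\to h(x),\ \zeta^k\to\zeta,\ \zeta^k\in\hat\partial h(x^k)\}$ (the usual convex subdifferential when $h$ is convex); both are empty for $x\notin\operatorname{dom}h$, and $\operatorname{dom}\partial h:=\{x:\partial h(x)\ne\emptyset\}$. Write $\operatorname{dist}(x,D):=\inf_{y\in D}\|x-y\|$ (with value $\infty$ if $D=\emptyset$). A proper closed $h$ satisfies the Kurdyka-Łojasiewicz (KL) property at $\hat x\in\operatorname{dom}\partial h$ with exponent $\alpha\in[0,1)$ if there exist $a\in(0,\infty]$, a neighborhood $V$ of $\hat x$ and $\bar c>0$ such that, with $\varphi(s)=\bar c s^{1-\alpha}$, $\varphi'(h(x)-h(\hat x))\operatorname{dist}(0,\partial h(x))\ge1$ for every $x\in V$ with $h(\hat x)<h(x)<h(\hat x)+a$. *)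

(* Defs.v *)
From HB Require Import structures.
From mathcomp Require Import all_boot all_order all_algebra.
From mathcomp Require Import all_classical all_reals all_analysis.

Set Implicit Arguments.
Unset Strict Implicit.
Unset Printing Implicit Defensive.

Import Order.TTheory GRing.Theory Num.Theory.
Import numFieldNormedType.Exports.

Local Open Scope classical_set_scope.
Local Open Scope ring_scope.

(* The library norm on 'rV[R]_n is the max norm. It induces the usual topology,
   so neighbourhoods and limits are the library's; lengths and distances are
   computed with the Euclidean norm below. *)
Definition dotv (R : realType) (n : nat) (u v : 'rV[R]_n) : R :=
  \sum_(j < n) u 0 j * v 0 j.

Definition enorm (R : realType) (n : nat) (u : 'rV[R]_n) : R :=
  Num.sqrt (dotv u u).

(* As [ereal_inf set0] is +oo, the distance to the empty set is +oo. *)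
Definition edistv (R : realType) (n : nat) (x : 'rV[R]_n) (D : set 'rV[R]_n) :
    \bar R :=
  ereal_inf [set (enorm (x - y))%:E | y in D].

Definition psdmx (R : realType) (d : nat) (A : 'M[R]_d) : Prop :=
  A \is symmetricmx /\ forall u : 'cV[R]_d, 0 <= (u^T *m A *m u) 0 0.

Definition pdmx (R : realType) (d : nat) (A : 'M[R]_d) : Prop :=
  A \is symmetricmx /\
  forall u : 'cV[R]_d, u != 0 -> 0 < (u^T *m A *m u) 0 0.

Definition affine_set (R : realType) (n : nat) (M : set 'rV[R]_n) : Prop :=
  forall x y t, M x -> M y -> M ((1 - t) *: x + t *: y).

Definition affine_hull (R : realType) (n : nat) (C : set 'rV[R]_n) :
    set 'rV[R]_n :=
  smallest (@affine_set R n) C.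

Definition relint (R : realType) (n : nat) (C : set 'rV[R]_n) :
    set 'rV[R]_n :=
  [set x | C x /\ \forall y \near x, affine_hull C y -> C y].

Definition edom (R : realType) (n : nat) (h : 'rV[R]_n -> \bar R) :
    set 'rV[R]_n :=
  [set x | (h x < +oo)%E].

Definition epi (R : realType) (n : nat) (h : 'rV[R]_n -> \bar R) :
    set ('rV[R]_n * R) :=
  [set p | (h p.1 <= p.2%:E)%E].

(* The first clause says that h takes its values in R U {+oo}. *)
Definition proper_fun (R : realType) (n : nat) (h : 'rV[R]_n -> \bar R) : Prop :=
  (forall x, h x != -oo%E) /\ edom h !=set0.

Definition reg_subdiff (R : realType) (n : nat) (h : 'rV[R]_n -> \bar R)
    (x : 'rV[R]_n) : set 'rV[R]_n :=
  [set zeta | edom h x /\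
    (0 <= limf_einf
            (fun z => (h z - h x - (dotv zeta (z - x))%:E)
                      * ((enorm (z - x))^-1)%:E) x^')%E].

Definition subdiff (R : realType) (n : nat) (h : 'rV[R]_n -> \bar R)
    (x : 'rV[R]_n) : set 'rV[R]_n :=
  [set zeta | edom h x /\
    exists (xs zetas : nat -> 'rV[R]_n),
      [/\ xs k @[k --> \oo] --> x,
          h (xs k) @[k --> \oo] --> h x,
          zetas k @[k --> \oo] --> zeta &
          forall k, reg_subdiff h (xs k) (zetas k)]].

Definition dom_subdiff (R : realType) (n : nat) (h : 'rV[R]_n -> \bar R) :
    set 'rV[R]_n :=
  [set x | subdiff h x !=set0].

Definition KL_desing (R : realType) (c alpha : R) : R -> R :=
  fun s => c * s `^ (1 - alpha).

Definition KL_property (R : realType) (n : nat) (h : 'rV[R]_n -> \bar R)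
    (xhat : 'rV[R]_n) (alpha : R) : Prop :=
  [/\ proper_fun h, lower_semicontinuous h, dom_subdiff h xhat,
      0 <= alpha < 1 &
      exists (a : \bar R) (V : set 'rV[R]_n) (c : R),
        [/\ (0 < a)%E, nbhs xhat V, 0 < c &
          forall x, V x -> (h xhat < h x)%E -> (h x < h xhat + a)%E ->
            (1 <= ((KL_desing c alpha)^`()%classic (fine (h x - h xhat)))%:E
                  * edistv 0%R (subdiff h x))%E]].

Definition sum_fun (R : realType) (n m : nat) (f : 'I_m -> 'rV[R]_n -> \bar R) :
    'rV[R]_n -> \bar R :=
  fun x => (\sum_(i < m) f i x)%E.

Definition lmi_pencil (R : realType) (n d : nat) (A00 A0 : 'M[R]_d)
    (A : 'I_n -> 'M[R]_d) (x : 'rV[R]_n) (t : R) : 'M[R]_d :=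
  A00 + \sum_(j < n) x 0 j *: A j + t *: A0.

Definition lmi_represents (R : realType) (n d : nat) (A00 A0 : 'M[R]_d)
    (A : 'I_n -> 'M[R]_d) (h : 'rV[R]_n -> \bar R) : Prop :=
  [/\ (0 < d)%N, A00 \is symmetricmx, A0 \is symmetricmx,
      (forall j, A j \is symmetricmx) &
      epi h = [set p | psdmx (lmi_pencil A00 A0 A p.1 p.2)]].

(* Main.v *)
(** By convexity, a subgradient [zeta] at [x] and a minimizer [y] satisfy
    [f x - f xbar <= <zeta, x - y>], so exponent 1/2 follows from quadratic
    growth: near [xbar], some minimizer [y] has
    [|x - y|^2 <= c (f x - f xbar)].

    Growth is proved in the variables [(x, t_1, ..., t_m)], for the pencil
    [G = diag (G_1, ..., G_m)] and its value [X] at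
    [(xbar, f_1 xbar, ..., f_m xbar)].  Let [K] span the kernel of [X].
    Slater's condition and [0 \in ri] say that a direction along which [K G K^T] stays
    nonnegative does not decrease [t_1 + ... + t_m], and keeps it constant only
    if [K G K^T] stays zero; by compactness
    [tr (K G K^T) <= C (f x - f xbar)] at feasible points.  Cauchy-Schwarz for
    [G >= 0] then gives [|K G| <= C' (f x - f xbar)^(1/2)], and Hoffman's bound
    moves the point by that much to one where the linear equations [K G = 0] hold.
    There [G] is a small perturbation of [X] that vanishes on the kernel of [X],
    hence positive semidefinite: the new point is feasible, and optimal. *)
Require Import Defs.
From mathcomp Require Import all_boot all_order all_algebra.
From mathcomp Require Import all_classical all_reals all_analysis.
From mathcomp Require Import ring lra.
Import Order.TTheory GRing.Theory Num.Theory.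
Import numFieldNormedType.Exports.
Local Open Scope classical_set_scope.
Local Open Scope ring_scope.

Set Implicit Arguments.
Unset Strict Implicit.
Unset Printing Implicit Defensive.

(** * Quadratic forms and positive semidefinite matrices *)

Section QuadraticForms.
Context {R : realType}.

Lemma dotvE n (u v : 'rV[R]_n) : dotv u v = (u *m v^T) 0 0.
Proof. by rewrite mxE; apply: eq_bigr => j _; rewrite mxE. Qed.

Lemma dotvC n (u v : 'rV[R]_n) : dotv u v = dotv v u.
Proof. by apply: eq_bigr => j _; rewrite mulrC. Qed.

Lemma dotvDl n (u v w : 'rV[R]_n) : dotv (u + v) w = dotv u w + dotv v w.
Proof. by rewrite !dotvE mulmxDl mxE. Qed.

Lemma dotvDr n (u v w : 'rV[R]_n) : dotv w (u + v) = dotv w u + dotv w v.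
Proof. by rewrite !(dotvC w) dotvDl. Qed.

Lemma dotvZl n (a : R) (u v : 'rV[R]_n) : dotv (a *: u) v = a * dotv u v.
Proof. by rewrite !dotvE -scalemxAl mxE. Qed.

Lemma dotvZr n (a : R) (u v : 'rV[R]_n) : dotv u (a *: v) = a * dotv u v.
Proof. by rewrite !(dotvC u) dotvZl. Qed.

Lemma dotvNl n (u v : 'rV[R]_n) : dotv (- u) v = - dotv u v.
Proof. by rewrite -scaleN1r dotvZl mulN1r. Qed.

Lemma dotvNr n (u v : 'rV[R]_n) : dotv u (- v) = - dotv u v.
Proof. by rewrite !(dotvC u) dotvNl. Qed.

Lemma dotv0l n (u : 'rV[R]_n) : dotv 0 u = 0.
Proof. by rewrite dotvE mul0mx mxE. Qed.

Lemma dotv_suml n (I : finType) (F : I -> 'rV[R]_n) v :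
  dotv (\sum_i F i) v = \sum_i dotv (F i) v.
Proof.
apply: (big_morph (fun u => dotv u v)) => [u w|]; last exact: dotv0l.
exact: dotvDl.
Qed.

Lemma dotv0r n (u : 'rV[R]_n) : dotv u 0 = 0.
Proof. by rewrite dotvC dotv0l. Qed.

Lemma dotv_ge0 n (u : 'rV[R]_n) : 0 <= dotv u u.
Proof. by apply: sumr_ge0 => j _; rewrite -expr2 sqr_ge0. Qed.

Lemma dotv_eq0 n (u : 'rV[R]_n) : (dotv u u == 0) = (u == 0).
Proof.
apply/eqP/eqP => [u0|->]; last exact: dotv0l.
apply/rowP => j; rewrite mxE; apply/eqP; rewrite -sqrf_eq0 expr2.
have /psumr_eq0P/(_ u0 j isT)-> // : forall j, true -> 0 <= u 0 j * u 0 j.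
by move=> k _; rewrite -expr2 sqr_ge0.
Qed.

Definition qf {d} (M : 'M[R]_d) (u v : 'rV[R]_d) : R := (u *m M *m v^T) 0 0.

(** Symmetry is left out and passed as a separate hypothesis [M^T = M]. Vectors are rows, so kernels
    below are left kernels. *)
Definition psd {d} (M : 'M[R]_d) : Prop := forall u, 0 <= qf M u u.

Lemma qfE d (M : 'M[R]_d) u v : qf M u v = dotv (u *m M) v.
Proof. by rewrite dotvE. Qed.

Lemma qfDl d (M : 'M[R]_d) u v w : qf M (u + v) w = qf M u w + qf M v w.
Proof. by rewrite !qfE mulmxDl dotvDl. Qed.

Lemma qfDr d (M : 'M[R]_d) u v w : qf M w (u + v) = qf M w u + qf M w v.
Proof. by rewrite !qfE dotvDr. Qed.

Lemma qfZl d (M : 'M[R]_d) a u w : qf M (a *: u) w = a * qf M u w.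
Proof. by rewrite !qfE -scalemxAl dotvZl. Qed.

Lemma qfZr d (M : 'M[R]_d) a u w : qf M w (a *: u) = a * qf M w u.
Proof. by rewrite !qfE dotvZr. Qed.

Lemma qf_mxD d (M N : 'M[R]_d) u v : qf (M + N) u v = qf M u v + qf N u v.
Proof. by rewrite !qfE mulmxDr dotvDl. Qed.

Lemma qf_mxZ d (M : 'M[R]_d) a u v : qf (a *: M) u v = a * qf M u v.
Proof. by rewrite !qfE -scalemxAr dotvZl. Qed.

Lemma qfC d (M : 'M[R]_d) u v : M^T = M -> qf M u v = qf M v u.
Proof.
move=> sM; rewrite /qf.
have -> : v *m M *m u^T = (u *m M *m v^T)^T.
  by rewrite !trmx_mul trmxK sM mulmxA.
by rewrite [RHS]mxE.
Qed.

Lemma qf_congr p d (K : 'M[R]_(p, d)) (M : 'M[R]_d) u v :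
  qf (K *m M *m K^T) u v = qf M (u *m K) (v *m K).
Proof. by rewrite /qf trmx_mul !mulmxA. Qed.

Lemma qf_deltal d (M : 'M[R]_d) i v : qf M (delta_mx 0 i) v = dotv (row i M) v.
Proof. by rewrite qfE -rowE. Qed.

Lemma dotv_delta n (u : 'rV[R]_n) i : dotv u (delta_mx 0 i) = u 0 i.
Proof.
rewrite /dotv (bigD1 i) //= big1 ?addr0; first by rewrite mxE !eqxx mulr1.
by move=> j /negPf ji; rewrite mxE ji andbF mulr0.
Qed.

Lemma qf_delta d (M : 'M[R]_d) i j :
  qf M (delta_mx 0 i) (delta_mx 0 j) = M i j.
Proof. by rewrite qf_deltal dotv_delta mxE. Qed.

Lemma symmxP d (M : 'M[R]_d) : (M \is symmetricmx) <-> M^T = M.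
Proof.
rewrite is_hermitianmxE /= expr0 scale1r map_mx_id //.
by split=> [/eqP/esym|->].
Qed.

Lemma psdmxP d (M : 'M[R]_d) : psdmx M <-> M^T = M /\ psd M.
Proof.
rewrite /psdmx symmxP; split=> -[sM pM]; split=> // u.
  by have := pM u^T; rewrite trmxK.
by have := pM u^T; rewrite /qf trmxK.
Qed.

(** The polynomial [qf M (u + t *: v) (u + t *: v)] in [t] is nonnegative; its value at
    [t = - b / c] gives the bound. If [c = 0] it is affine, which forces [b = 0]. *)
Lemma psd_CS d (M : 'M[R]_d) u v : M^T = M -> psd M ->
  qf M u v ^+ 2 <= qf M u u * qf M v v.
Proof.
move=> sM pM; set a := qf M u u; set b := qf M u v; set c := qf M v v.
have key t : 0 <= a + 2 * t * b + t ^+ 2 * c.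
  have := pM (u + t *: v); rewrite qfDl !qfDr !qfZl !qfZr (qfC v u sM).
  by rewrite -/a -/b -/c; lra.
have a0 : 0 <= a := pM u.
have c0 : 0 <= c := pM v.
have [c_eq0|cn0] := eqVneq c 0.
  have [->|bn0] := eqVneq b 0; first by rewrite expr0n mulr_ge0.
  (* At this [t] the affine polynomial would equal -1. *)
  have := key (- (a + 1) / (2 * b)); rewrite c_eq0 !mulr0 addr0.
  have -> : 2 * (- (a + 1) / (2 * b)) * b = - (a + 1) by field.
  lra.
have cp : 0 < c by rewrite lt_def cn0.
have := key (- b / c).
have -> : a + 2 * (- b / c) * b + (- b / c) ^+ 2 * c = (a * c - b ^+ 2) / c.
  by field.
by rewrite pmulr_lge0 ?invr_gt0// subr_ge0.
Qed.

Lemma dotv_CS n (u v : 'rV[R]_n) : dotv u v ^+ 2 <= dotv u u * dotv v v.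
Proof.
have E (x y : 'rV[R]_n) : dotv x y = qf 1%:M x y by rewrite qfE mulmx1.
rewrite !E; apply: psd_CS; first exact: trmx1.
by move=> x; rewrite -E dotv_ge0.
Qed.

(** * The squared Frobenius norm and bounds for positive semidefinite matrices *)

Definition fro2 {p q} (M : 'M[R]_(p, q)) : R := \sum_i \sum_j M i j ^+ 2.

Lemma fro2_ge0 p q (M : 'M[R]_(p, q)) : 0 <= fro2 M.
Proof. by apply: sumr_ge0 => i _; apply: sumr_ge0 => j _; exact: sqr_ge0. Qed.

Lemma dotv_mulmx_le p q (M : 'M[R]_(p, q)) u :
  dotv (u *m M) (u *m M) <= fro2 M * dotv u u.
Proof.
rewrite /fro2 exchange_big /= mulr_suml; apply: ler_sum => j _.
have -> : (u *m M) 0 j = dotv u (col j M)^T.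
  by rewrite mxE; apply: eq_bigr => i _; rewrite !mxE.
rewrite -expr2 (le_trans (dotv_CS _ _))// mulrC ler_wpM2r ?dotv_ge0//.
by apply: ler_sum => i _; rewrite !mxE expr2.
Qed.

Lemma qf_le_fro2 d (M : 'M[R]_d) u v :
  qf M u v ^+ 2 <= fro2 M * dotv u u * dotv v v.
Proof.
rewrite qfE (le_trans (dotv_CS _ _))//.
by rewrite ler_wpM2r ?dotv_ge0// dotv_mulmx_le.
Qed.

Lemma qf_bound d (M : 'M[R]_d) (k : R) u v : 0 <= k -> fro2 M <= k ^+ 2 ->
  `|qf M u v| <= k * enorm u * enorm v.
Proof.
move=> k0 Mk; rewrite -(@ler_sqr _ `|_|) ?nnegrE ?mulr_ge0 ?sqrtr_ge0//.
rewrite real_normK ?num_real// (le_trans (qf_le_fro2 _ _ _))//.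
rewrite !exprMn !sqr_sqrtr ?dotv_ge0//.
by rewrite !ler_wpM2r ?dotv_ge0.
Qed.

Lemma psd_tr_ge0 d (M : 'M[R]_d) : psd M -> 0 <= \tr M.
Proof. by move=> pM; apply: sumr_ge0 => i _; rewrite -qf_delta. Qed.

(** Each entry of [K *m M] is the form of [M] at a row of [K] and a basis vector, so Cauchy-Schwarz
    applies entrywise. This is the source of the exponent: a trace of order e gives a norm of order
    sqrt e. *)
Lemma psd_mulmx_le d p (K : 'M[R]_(p, d)) (M : 'M[R]_d) : M^T = M -> psd M ->
  fro2 (K *m M) <= \tr (K *m M *m K^T) * \tr M.
Proof.
move=> sM pM; rewrite mulr_suml; apply: ler_sum => a _.
rewrite mulr_sumr; apply: ler_sum => b _.
have -> : (K *m M) a b = qf M (row a K) (delta_mx 0 b).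
  by rewrite qfE dotv_delta -row_mul [RHS]mxE.
have -> : (K *m M *m K^T) a a = qf M (row a K) (row a K).
  by rewrite -qf_delta qf_congr -!rowE.
by rewrite -[M b b]qf_delta psd_CS.
Qed.

Lemma psd_fro2_le d (M : 'M[R]_d) : M^T = M -> psd M -> fro2 M <= \tr M ^+ 2.
Proof.
move=> sM pM; rewrite expr2; have := psd_mulmx_le 1%:M sM pM.
by rewrite trmx1 mulmx1 mul1mx.
Qed.

Lemma fro2_eq0 p q (M : 'M[R]_(p, q)) : fro2 M = 0 -> M = 0.
Proof.
move=> M0; apply/matrixP => i j; rewrite mxE; apply/eqP; rewrite -sqrf_eq0.
have S k : 0 <= \sum_l M k l ^+ 2 by apply: sumr_ge0 => l _; exact: sqr_ge0.
have /psumr_eq0P/(_ M0 i isT) Mi : forall k, true -> 0 <= \sum_l M k l ^+ 2.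
  by move=> k _.
have /psumr_eq0P/(_ Mi j isT)-> // : forall l, true -> 0 <= M i l ^+ 2.
by move=> l _; exact: sqr_ge0.
Qed.

Lemma psd_tr0 d (M : 'M[R]_d) : M^T = M -> psd M -> \tr M = 0 -> M = 0.
Proof.
move=> sM pM t0; apply: fro2_eq0; apply/eqP.
by rewrite eq_le fro2_ge0 andbT (le_trans (psd_fro2_le sM pM))// t0 expr0n.
Qed.

(** The component off the kernel is [u *m X *m pinvmx X], and Cauchy-Schwarz bounds |u X|^2 by
    [qf X u u * \tr X]. *)
Lemma psd_coercive d (X : 'M[R]_d) : X^T = X -> psd X ->
  exists2 k, 0 < k & forall u, exists2 u', u' *m X = 0 &
    k * dotv (u - u') (u - u') <= qf X u u.
Proof.
move=> sX pX; have t0 := psd_tr_ge0 pX.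
have f0 := fro2_ge0 (pinvmx X).
pose c := fro2 (pinvmx X) * \tr X + 1.
have c0 : 0 < c by rewrite ltr_wpDl ?mulr_ge0.
exists c^-1; rewrite ?invr_gt0// => u; exists (u - u *m X *m pinvmx X).
  by rewrite mulmxBl mulmxKpV ?submxMl// subrr.
rewrite subKr mulrC ler_pdivrMr//.
rewrite (le_trans (dotv_mulmx_le _ _))//.
have uX : dotv (u *m X) (u *m X) <= qf X u u * \tr X.
  rewrite mulr_sumr; apply: ler_sum => j _.
  by rewrite -expr2 -dotv_delta -qfE (le_trans (psd_CS _ _ sX pX))// qf_delta.
rewrite (le_trans (ler_wpM2l f0 uX))// /c.
by have := pX u; nra.
Qed.

(** [E] sees only the component of [u] off the kernel of [X], where [X] is coercive and outweighs
    it. *)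
Lemma psd_perturb d (X : 'M[R]_d) : X^T = X -> psd X ->
  exists2 r, 0 < r & forall E : 'M[R]_d, E^T = E -> fro2 E <= r ->
    (forall u : 'rV[R]_d, u *m X = 0 -> u *m E = 0) -> psd (X + E).
Proof.
move=> sX pX; have [k k0 kX] := psd_coercive sX pX.
exists (k ^+ 2); rewrite ?exprn_gt0// => E sE Ek E0 u; rewrite qf_mxD.
have [v /E0 vE uv] := kX u.
have -> : qf E u u = qf E (u - v) (u - v).
  have v0 w' : qf E v w' = 0 by rewrite qfE vE dotv0l.
  have -> : qf E u u = qf E (u - v + v) (u - v + v) by rewrite subrK.
  by move: (u - v) => w; rewrite qfDl v0 addr0 qfDr (qfC w v sE) v0 addr0.
have := qf_bound (u - v) (u - v) (ltW k0) Ek.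
rewrite -mulrA -expr2 sqr_sqrtr ?dotv_ge0// ler_norml => /andP[+ _].
lra.
Qed.

(** [X] is coercive off its kernel and [E] on it; for a short step, [X] absorbs the mixed term and
    the form of [E] off the kernel. *)
Lemma psd_move d (X E : 'M[R]_d) (k : R) : X^T = X -> psd X -> E^T = E ->
  0 < k -> (forall u, u *m X = 0 -> k * dotv u u <= qf E u u) ->
  exists2 s, 0 < s & psd (X + s *: E).
Proof.
move=> sX pX sE k0 kE; have [c c0 cX] := psd_coercive sX pX.
pose f := fro2 E + 1; have f1 : 1 <= f by rewrite lerDr fro2_ge0.
have fE : fro2 E <= f ^+ 2 by rewrite expr2 /f; have := fro2_ge0 E; nra.
have f0 : 0 < f := lt_le_trans ltr01 f1.
have D0 : 0 < f + f ^+ 2 / k by rewrite addr_gt0 // divr_gt0 ?exprn_gt0.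
(* The summand [f] pays for [qf E w w]; [f ^+ 2 / k] completes the square with the mixed term. *)
exists (c / (f + f ^+ 2 / k)); first exact: divr_gt0.
set s := c / _; have s0 : 0 < s by exact: divr_gt0.
have sc : c = s * (f + f ^+ 2 / k) by rewrite /s; field; rewrite ?gt_eqF//; nra.
move=> u; rewrite qf_mxD qf_mxZ; have [v vX uv] := cX u.
apply: le_trans (_ : 0 <= c * dotv (u - v) (u - v) + s * qf E u u) _; last first.
  by rewrite lerD2r.
have -> : qf E u u = qf E (u - v + v) (u - v + v) by rewrite subrK.
move: (u - v) => w {uv}; rewrite qfDl !qfDr (qfC v w sE).
have vv := kE v vX.
have := qf_bound w w (ltW f0) fE; have := qf_bound w v (ltW f0) fE.
rewrite !ler_norml => /andP[h1 _] /andP[h2 _].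
have ew : dotv w w = enorm w ^+ 2 by rewrite sqr_sqrtr ?dotv_ge0.
have ev : dotv v v = enorm v ^+ 2 by rewrite sqr_sqrtr ?dotv_ge0.
rewrite ew sc; rewrite ev in vv.
set p := enorm w in h1 h2 *; set q := enorm v in h1 vv *.
have -> : forall y, s * (f + f ^+ 2 / k) * p ^+ 2 + s * y =
    s * ((f + f ^+ 2 / k) * p ^+ 2 + y) by move=> y; ring.
apply: mulr_ge0; first exact: ltW.
have sq : 0 <= k * (q - f / k * p) ^+ 2 by rewrite mulr_ge0 ?sqr_ge0// ltW.
have E1 : k * (q - f / k * p) ^+ 2 =
    k * q ^+ 2 - 2 * (f * p * q) + f ^+ 2 / k * p ^+ 2.
  by field; rewrite gt_eqF.
have E2 : f * p * p = f * p ^+ 2 by ring.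
rewrite E1 in sq; rewrite E2 in h2; lra.
Qed.

(** * Linear combinations of matrices *)

Lemma mxvec_dotv p q (M : 'M[R]_(p, q)) : dotv (mxvec M) (mxvec M) = fro2 M.
Proof.
rewrite /dotv (reindex _ (curry_mxvec_bij _ _)) /= /fro2 pair_bigA /=.
by apply: eq_bigr => -[i j] _ /=; rewrite mxvecE expr2.
Qed.

Definition lincomb {N p q} (H : 'I_N -> 'M[R]_(p, q)) (w : 'rV[R]_N) :=
  \sum_k w 0 k *: H k.

Lemma lincombD N p q (H : 'I_N -> 'M[R]_(p, q)) u v :
  lincomb H (u + v) = lincomb H u + lincomb H v.
Proof.
by rewrite /lincomb -big_split; apply: eq_bigr => k _; rewrite mxE scalerDl.
Qed.

Lemma lincombZ N p q (H : 'I_N -> 'M[R]_(p, q)) a u :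
  lincomb H (a *: u) = a *: lincomb H u.
Proof.
by rewrite /lincomb scaler_sumr; apply: eq_bigr => k _; rewrite mxE scalerA.
Qed.

Lemma lincombN N p q (H : 'I_N -> 'M[R]_(p, q)) u :
  lincomb H (- u) = - lincomb H u.
Proof. by rewrite -scaleN1r lincombZ scaleN1r. Qed.

Lemma lincomb_mul N p q a b (H : 'I_N -> 'M[R]_(p, q)) (A : 'M[R]_(a, p))
  (B : 'M[R]_(q, b)) w :
  lincomb (fun k => A *m H k *m B) w = A *m lincomb H w *m B.
Proof.
rewrite /lincomb mulmx_sumr mulmx_suml; apply: eq_bigr => k _.
by rewrite -scalemxAr -scalemxAl.
Qed.

Lemma lincomb_mull N p q a (H : 'I_N -> 'M[R]_(p, q)) (A : 'M[R]_(a, p)) w :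
  lincomb (fun k => A *m H k) w = A *m lincomb H w.
Proof.
by rewrite /lincomb mulmx_sumr; apply: eq_bigr => k _; rewrite -scalemxAr.
Qed.

Lemma trmx_lincomb N d (H : 'I_N -> 'M[R]_d) w :
  (forall k, (H k)^T = H k) -> (lincomb H w)^T = lincomb H w.
Proof.
by move=> sH; rewrite /lincomb linear_sum /=; apply: eq_bigr => k _;
  rewrite linearZ /= sH.
Qed.

Lemma lincomb_mxvec N p q (H : 'I_N -> 'M[R]_(p, q)) w :
  mxvec (lincomb H w) = w *m \matrix_k mxvec (H k).
Proof.
rewrite mulmx_sum_row /lincomb linear_sum; apply: eq_bigr => k _.
by rewrite linearZ /= rowK.
Qed.

Lemma fro2_lincomb_le N p q (H : 'I_N -> 'M[R]_(p, q)) : exists2 c, 0 < c &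
  forall w, fro2 (lincomb H w) <= c * dotv w w.
Proof.
exists (fro2 (\matrix_k mxvec (H k)) + 1); first by rewrite ltr_wpDl ?fro2_ge0.
move=> w; rewrite -mxvec_dotv lincomb_mxvec (le_trans (dotv_mulmx_le _ _))//.
by rewrite ler_wpM2r ?dotv_ge0 ?lerDl.
Qed.

(** Hoffman's bound for linear equations: after vectorization [lincomb H] is multiplication by [T],
    and the partial inverse of [T] supplies the correction. *)
Lemma lincomb_hoffman N p q (H : 'I_N -> 'M[R]_(p, q)) :
  exists2 c, 0 < c & forall w, exists2 w', lincomb H w' = 0 &
    dotv (w - w') (w - w') <= c * fro2 (lincomb H w).
Proof.
set T := \matrix_k mxvec (H k).
exists (fro2 (pinvmx T) + 1); first by rewrite ltr_wpDl ?fro2_ge0.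
move=> w; exists (w - w *m T *m pinvmx T).
  apply/eqP; rewrite -mxvec_eq0 lincomb_mxvec -/T.
  by rewrite mulmxBl mulmxKpV ?submxMl// subrr.
rewrite subKr -(mxvec_dotv (lincomb H w)) lincomb_mxvec -/T.
rewrite (le_trans (dotv_mulmx_le _ _))//.
by rewrite ler_wpM2r ?dotv_ge0 ?lerDl.
Qed.

End QuadraticForms.

(** * Quadratic growth for linear matrix inequalities *)

Section QuadraticGrowth.
Context {R : realType}.

Lemma cvg_dotv (T : Type) (F : set_system T) n (f g : T -> 'rV[R]_n) a b :
  Filter F -> f @ F --> a -> g @ F --> b ->
  dotv (f x) (g x) @[x --> F] --> dotv a b.
Proof.
move=> FF fa gb; apply: cvg_big => [|j _]; first exact: add_continuous.
have cc (h : T -> 'rV[R]_n) (c : 'rV[R]_n) : h @ F --> c -> h x 0 j @[x --> F] --> c 0 j.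
  by move=> hc; exact: (cvg_comp _ _ hc (@coord_continuous R 1 n 0 j c)).
by apply: cvgM; exact: cc.
Qed.

Lemma dotv_continuousr n (a : 'rV[R]_n) : continuous (dotv a).
Proof.
move=> x; apply: (@cvg_dotv _ (nbhs x) _ (fun=> a) id a x).
  exact: cvg_cst.
exact: cvg_id.
Qed.

Lemma normr_le_enorm n (u : 'rV[R]_n) : `|u| <= enorm u.
Proof.
rewrite [leLHS]/Num.norm/= mx_normrE; apply/bigmax_leP; split=> [|[i j] _ /=].
  exact: sqrtr_ge0.
rewrite -sqrtr_sqr ler_wsqrtr// (ord1 i) /dotv (bigD1 j)//= -expr2 lerDl.
by apply: sumr_ge0 => k _; rewrite -expr2 sqr_ge0.
Qed.

Lemma qf_lincomb N d (H : 'I_N -> 'M[R]_d) u v w :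
  qf (lincomb H w) u v = dotv (\row_k qf (H k) u v) w.
Proof.
rewrite /qf /lincomb mulmx_sumr mulmx_suml summxE; apply: eq_bigr => k _.
by rewrite -scalemxAr -scalemxAl !mxE mulrC.
Qed.

Lemma tr_lincomb N d (H : 'I_N -> 'M[R]_d) w :
  \tr (lincomb H w) = dotv (\row_k \tr (H k)) w.
Proof.
rewrite /lincomb linear_sum; apply: eq_bigr => k _.
by rewrite linearZ /= !mxE mulrC.
Qed.

(** Both sides ignore the kernel of [lincomb B], so cone elements of trace 1 have representatives in
    a compact set. There [s] is positive, and its minimum is the constant. *)
Lemma psd_cone_bound N p (B : 'I_N -> 'M[R]_p) (s : 'rV[R]_N) :
    (forall k, (B k)^T = B k) ->
    (forall w, psd (lincomb B w) ->
       0 <= dotv s w /\ (dotv s w = 0 -> lincomb B w = 0)) ->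
  exists2 k, 0 < k &
    forall w, psd (lincomb B w) -> k * \tr (lincomb B w) <= dotv s w.
Proof.
move=> sB sP; have symB w := trmx_lincomb w sB.
have [c c0 cB] := lincomb_hoffman B.
have ker0 w : lincomb B w = 0 -> dotv s w = 0.
  move=> Bw; have p0 : psd (0 : 'M[R]_p).
    by move=> u; rewrite qfE mulmx0 dotv0l.
  have [s1 _] : 0 <= dotv s w /\ (dotv s w = 0 -> lincomb B w = 0).
    by apply: sP; rewrite Bw.
  have [s2 _] : 0 <= dotv s (- w) /\ (dotv s (- w) = 0 -> lincomb B (- w) = 0).
    by apply: sP; rewrite lincombN Bw oppr0.
  by apply/eqP; rewrite eq_le s1 andbT -oppr_ge0 -dotvNr.
(* The radius is Hoffman's constant: removing a kernel element and dividing by the trace brings each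
   cone element of positive trace into [S]. *)
pose S := [set w | psd (lincomb B w)] `&` [set w | \tr (lincomb B w) = 1]
  `&` [set w : 'rV[R]_N | dotv w w <= c].
have reduce w : psd (lincomb B w) -> 0 < \tr (lincomb B w) ->
    exists2 v, S v & dotv s w = \tr (lincomb B w) * dotv s v.
  move=> pw; set t := \tr _ => t0; have [w' w'0 ww'] := cB w.
  have Bww' : lincomb B (w - w') = lincomb B w.
    by rewrite lincombD lincombN w'0 subr0.
  exists (t^-1 *: (w - w')).
    split; first split.
    - move=> u; rewrite lincombZ qf_mxZ Bww'.
      by apply: mulr_ge0; [rewrite invr_ge0 ltW|exact: pw].
    - by rewrite /= lincombZ Bww' linearZ /= -/t mulVf ?gt_eqF.
    rewrite /= dotvZl dotvZr mulrA -invfM mulrC ler_pdivrMr ?mulr_gt0//.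
    rewrite (le_trans ww')// ler_wpM2l ?(ltW c0)//.
    by rewrite (le_trans (psd_fro2_le (symB w) pw)).
  by rewrite dotvZr mulrA divff ?gt_eqF// mul1r dotvDr dotvNr (ker0 w')// subr0.
(* If [S] is empty, no cone element has positive trace and any constant works. *)
have [S0|/set0P S0] := eqVneq S set0.
  exists 1 => // w pw; rewrite mul1r.
  have [t0|t0] := leP (\tr (lincomb B w)) 0.
    by rewrite (le_trans t0)//; case: (sP w pw).
  by have [v] := reduce w pw t0; rewrite S0.
have cS : compact S.
  apply: bounded_closed_compact.
    exists (Num.sqrt c); split; first exact: num_real.
    move=> x cx w /= [_ /= wc]; rewrite (le_trans (normr_le_enorm w))//.
    by rewrite (le_trans _ (ltW cx))// ler_wsqrtr.
  apply: closedI; first apply: closedI.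
  - rewrite (_ : [set w | _] = \bigcap_(u in setT)
      (dotv (\row_k qf (B k) u u) @^-1` [set y | 0 <= y])).
      apply: closed_bigI => u _; apply: preimage_closed; last exact: closed_ge.
      by move=> x _; exact: dotv_continuousr.
    apply/seteqP; split=> [w pw u _|w pw u]; first by rewrite /= -qf_lincomb.
    by rewrite qf_lincomb; exact: (pw u I).
  - rewrite (_ : [set w | _] = dotv (\row_k \tr (B k)) @^-1` [set y | y = 1]).
      apply: preimage_closed; last exact: closed_eq.
      by move=> x _; exact: dotv_continuousr.
    by apply/seteqP; split=> w; rewrite /= tr_lincomb.
  - apply: (@preimage_closed _ _ (fun w : 'rV[R]_N => dotv w w) [set y | y <= c]);
      last exact: closed_le.
    by move=> x _; apply: (@cvg_dotv _ (nbhs x) _ id id x x); exact: cvg_id.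
have [v + vmin] : exists2 v, v \in S & forall w, w \in S -> dotv s v <= dotv s w.
  apply: compact_EVT_min => //; apply: continuous_subspaceT.
  exact: dotv_continuousr.
rewrite inE => -[[pv /= tv] _].
have [sv0 sv] := sP v pv.
have svp : 0 < dotv s v.
  rewrite lt_def sv0 andbT; apply/eqP => /sv v0.
  by move: tv; rewrite v0 mxtrace0 => /eqP; rewrite eq_sym oner_eq0.
exists (dotv s v) => // w pw.
have [t0|t0] := leP (\tr (lincomb B w)) 0.
  by case: (sP w pw) => sw _; rewrite (le_trans _ sw)// mulr_ge0_le0.
have [x Sx ->] := reduce w pw t0.
by rewrite mulrC ler_wpM2l ?(ltW t0)// vmin// inE.
Qed.

(** [K] is square: its rows span the left kernel of [X] but may be redundant. *)
Lemma ker_basis d (X : 'M[R]_d) : exists2 K : 'M[R]_d, K *m X = 0 &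
  forall u : 'rV[R]_d, u *m X = 0 -> exists v, u = v *m K.
Proof.
exists (kermx X); first exact: mulmx_ker.
by move=> u /sub_kermxP/submxP.
Qed.

(* Positivity is only required on the kernel of [X]: these are the first-order
   feasible directions of the inequality [X + lincomb H w >= 0] at [w = 0]. *)
Lemma quadratic_growth N d (X : 'M[R]_d) (H : 'I_N -> 'M[R]_d) (s : 'rV[R]_N) :
    X^T = X -> psd X -> (forall k, (H k)^T = H k) ->
    (forall w, (forall u, u *m X = 0 -> 0 <= qf (lincomb H w) u u) ->
       0 <= dotv s w /\
       (dotv s w = 0 -> forall u, u *m X = 0 -> qf (lincomb H w) u u = 0)) ->
  exists r c : R, [/\ 0 < r, 0 < c & forall w,
    dotv w w <= r -> dotv s w <= r -> psd (X + lincomb H w) ->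
    exists w', [/\ psd (X + lincomb H w'), dotv s w' = 0 &
      dotv (w - w') (w - w') <= c * dotv s w]].
Proof.
move=> sX pX sH sP; have symH w := trmx_lincomb w sH.
have [K KX kerP] := ker_basis X.
pose B k := K *m H k *m K^T.
have BE w : lincomb B w = K *m lincomb H w *m K^T by rewrite lincomb_mul.
have sB k : (B k)^T = B k by rewrite /B !trmx_mul trmxK sH mulmxA.
have kerB w u : qf (lincomb B w) u u = qf (lincomb H w) (u *m K) (u *m K).
  by rewrite BE qf_congr.
have BP w : psd (lincomb B w) ->
    0 <= dotv s w /\ (dotv s w = 0 -> lincomb B w = 0).
  move=> pw; have [|s0 s1] := sP w.
    by move=> u /kerP[v ->]; rewrite -kerB.
  split=> // /s1 s2; apply: psd_tr0 => //; first exact: trmx_lincomb.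
  apply: big1 => i _; rewrite -qf_delta kerB s2//.
  by rewrite -mulmxA KX mulmx0.
have [k k0 kP] := psd_cone_bound sB BP.
have [h h0 hP] := lincomb_hoffman (fun k => K *m H k).
have [r r0 rP] := psd_perturb sX pX.
have [l l0 lP] := fro2_lincomb_le H.
pose tau := \row_k \tr (H k).
(* This bounds the trace of the pencil for |w| <= 1, since 2 <tau, w> <= |tau|^2 + |w|^2. *)
pose t := \tr X + (1 + dotv tau tau).
have t0 : 0 < t by rewrite ltr_wpDl ?psd_tr_ge0// ltr_pwDl ?dotv_ge0.
pose c := h * (t / k); have c0 : 0 < c by rewrite mulr_gt0 ?divr_gt0.
have l4 : 0 < 4 * l by rewrite mulr_gt0.
have l4c : 0 < 4 * l * c := mulr_gt0 l4 c0.
(* The bound 1 serves the trace estimate; the other two make each half of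
   [2 * |w|^2 + 2 * |w - w'|^2] contribute at most [r / 2] after multiplication by [l]. *)
pose e := Num.min 1 (Num.min (r / (4 * l)) (r / (4 * l * c))).
exists e, c; split=> //.
  by rewrite !lt_min ltr01 (divr_gt0 r0 l4) (divr_gt0 r0 l4c).
move=> w; rewrite !le_min => /and3P[w1 w2 _] /and3P[_ _ s3] pw.
have symM : (X + lincomb H w)^T = X + lincomb H w by rewrite linearD /= sX symH.
have KM : K *m (X + lincomb H w) = K *m lincomb H w by rewrite mulmxDr KX add0r.
have BM : lincomb B w = K *m (X + lincomb H w) *m K^T by rewrite KM BE.
have pB : psd (lincomb B w) by move=> u; rewrite BM qf_congr.
have trM : \tr (X + lincomb H w) <= t.
  rewrite linearD /= lerD2l tr_lincomb -/tau.
  have := dotv_ge0 (tau - w); rewrite dotvDl !dotvDr !dotvNl !dotvNr (dotvC w).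
  by have := dotv_ge0 tau; lra.
have froK : fro2 (K *m lincomb H w) <= (t / k) * dotv s w.
  rewrite -KM (le_trans (psd_mulmx_le K symM pw))// -BM.
  have kw := kP w pB; have trB := psd_tr_ge0 pB.
  have trB' : \tr (lincomb B w) <= dotv s w / k by rewrite ler_pdivlMr// mulrC.
  rewrite (le_trans (ler_wpM2l trB trM))// (le_trans (ler_wpM2r (ltW t0) trB'))//.
  by rewrite mulrC mulrA mulrAC.
have [w' w'0 ww'] := hP w; exists w'.
have ww'c : dotv (w - w') (w - w') <= c * dotv s w.
  rewrite (le_trans ww')// lincomb_mull /c -mulrA ler_wpM2l//.
  exact: ltW.
have Kw' : K *m lincomb H w' = 0 by rewrite -lincomb_mull.
split=> //; last first.
  (* Both [w'] and [- w'] have zero compression, so [s] is nonnegative at both. *)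
  have Bw' : lincomb B w' = 0 by rewrite BE Kw' mul0mx.
  have p0 x : lincomb B x = 0 -> psd (lincomb B x).
    by move=> -> u; rewrite qfE mulmx0 dotv0l.
  have [s1 _] := BP w' (p0 _ Bw').
  have [|s2 _] := BP (- w'); first by apply: p0; rewrite lincombN Bw' oppr0.
  by apply/eqP; rewrite eq_le s1 andbT -oppr_ge0 -dotvNr.
(* [lincomb H w'] vanishes on the kernel of [X], so only its smallness and that vanishing remain to
   be checked. *)
apply: rP => //.
  rewrite (le_trans (lP w'))//.
  have w'2 : dotv w' w' <= 2 * dotv w w + 2 * dotv (w - w') (w - w').
    have := dotv_ge0 (2 *: w - w').
    by rewrite !(dotvDl, dotvDr, dotvNl, dotvNr, dotvZl, dotvZr) (dotvC w'); lra.
  move: w2; rewrite (ler_pdivlMr _ _ l4) => w2.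
  move: s3; rewrite (ler_pdivlMr _ _ l4c) => s3.
  rewrite (le_trans (ler_wpM2l (ltW l0) w'2))//.
  have := ler_wpM2l (ltW l0) ww'c; lra.
by move=> u /kerP[v ->]; rewrite -mulmxA Kw' mulmx0.
Qed.

End QuadraticGrowth.

(** * Subgradients and the KL property of convex functions *)

Section ConvexAnalysis.
Context {R : realType} {n : nat}.
Implicit Types (h : 'rV[R]_n -> \bar R) (x y zeta : 'rV[R]_n).

Lemma ereal_finE (a : \bar R) : a != -oo%E -> (a < +oo)%E -> exists r, a = r%:E.
Proof. by case: a => [r| |] //; exists r. Qed.

(** Real upper bounds stand for the values, here and in [subgrad], to avoid arithmetic with
    infinities. *)
Definition convex_epi h : Prop :=
  forall x y (t s e : R), 0 <= e <= 1 -> (h x <= t%:E)%E -> (h y <= s%:E)%E ->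
    (h (x + e *: (y - x))%R <= (t + e * (s - t))%R%:E)%E.

Definition subgrad h x (a : R) zeta : Prop :=
  forall y t, (h y <= t%:E)%E -> a + dotv zeta (y - x) <= t.

(** If the inequality failed at [y], convexity would keep the difference quotients along the segment
    from [x] to [y] below a fixed negative number [q], and so the lower limit too. *)
Lemma reg_subdiff_subgrad h x a zeta : (forall y, h y != -oo%E) ->
  convex_epi h -> h x = a%:E -> reg_subdiff h x zeta -> subgrad h x a zeta.
Proof.
move=> hNy hc hx [_ ]; rewrite limf_einfE => lim0 y t hyt.
rewrite leNgt; apply/negP => lt_t.
have yx : y - x != 0.
  apply: contraTneq lt_t => yx; rewrite yx dotv0r addr0 -leNgt -lee_fin -hx.
  by move/eqP: yx; rewrite subr_eq0 => /eqP <-.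
have D0 : 0 < enorm (y - x) by rewrite sqrtr_gt0 lt_def dotv_ge0 dotv_eq0 yx.
set q := (t - a - dotv zeta (y - x)) / enorm (y - x).
have q0 : q < 0 by rewrite pmulr_llt0 ?invr_gt0//; lra.
suff : (0%:E <= q%:E)%E by rewrite lee_fin leNgt q0.
apply: (le_trans lim0); apply: ge_ereal_sup => _ [V xV <-].
have /nbhs_normP[r r0 rV] := xV.
(* The point at parameter [e] of the segment is within [r / 2] of [x]. *)
pose e := Num.min 1 (r / (2 * `|y - x|)).
have nyx : 0 < `|y - x| by rewrite normr_gt0.
have e0 : 0 < e by rewrite lt_min ltr01 divr_gt0// mulr_gt0.
have e1 : e <= 1 by rewrite ge_min lexx.
pose z := x + e *: (y - x).
have zx : z - x = e *: (y - x) by rewrite /z addrC addKr.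
have Vz : V z.
  apply: rV.
    rewrite /ball_/= -normrN opprB zx normrZ gtr0_norm//.
    have : e <= r / (2 * `|y - x|) by rewrite ge_min lexx orbT.
    rewrite ler_pdivlMr ?mulr_gt0// => er.
    have : 0 < e * `|y - x| by rewrite mulr_gt0.
    move: r0 => /=; lra.
  by rewrite -subr_eq0 zx scaler_eq0 negb_or gt_eqF.
have hz : (h z <= (a + e * (t - a))%R%:E)%E.
  by apply: hc => //; [rewrite ltW//= | rewrite hx].
have [b hb] : exists b, h z = b%:E.
  by apply: ereal_finE => //; rewrite (le_lt_trans hz)// ltry.
apply: (le_trans (ereal_inf_lbound _)); first by exists z.
rewrite hb hx -!EFinB -EFinM lee_fin zx.
have -> : enorm (e *: (y - x)) = e * enorm (y - x).
  by rewrite /enorm dotvZl dotvZr mulrA -expr2 sqrtrM ?sqr_ge0// sqrtr_sqr gtr0_norm.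
rewrite dotvZr ler_pdivrMr ?mulr_gt0//.
have -> : q * (e * enorm (y - x)) = (t - a - dotv zeta (y - x)) * e.
  by rewrite /q; field; rewrite gt_eqF.
by move: hz; rewrite hb lee_fin; lra.
Qed.

(** The inequality holds for the approximating regular subgradients and passes to the limit. *)
Lemma subdiff_subgrad h x a zeta : (forall y, h y != -oo%E) ->
  convex_epi h -> h x = a%:E -> subdiff h x zeta -> subgrad h x a zeta.
Proof.
move=> hNy hc hx [_ [xs [zs [cx ch cz rz]]]] y t hyt.
have hfin k : h (xs k) = (fine (h (xs k)))%:E.
  have [b ->] // : exists b, h (xs k) = b%:E.
  by apply: ereal_finE => //; case: (rz k).
rewrite hx in ch; have cf := fine_cvg ch.
have cd : dotv (zs k) (y - xs k) @[k --> \oo] --> dotv zeta (y - x).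
  apply: (@cvg_dotv _ _ \oo _ zs (fun k => y - xs k)) => //.
  by apply: cvgB => //; exact: cvg_cst.
apply: (cvgr_to_le (F := \oo) (f := (fine \o (fun k => h (xs k))) \+
  fun k => dotv (zs k) (y - xs k))).
  exact: (cvgD (cf _) cd).
apply: nearW => k /=; exact: (reg_subdiff_subgrad hNy hc (hfin k) (rz k)).
Qed.

(** Constant sequences suffice: every difference quotient is nonnegative. *)
Lemma subgrad_subdiff h x a zeta : (forall y, h y != -oo%E) ->
  h x = a%:E -> subgrad h x a zeta -> subdiff h x zeta.
Proof.
move=> hNy hx sz; have dx : edom h x by rewrite /edom /= hx ltry.
split=> //; exists (fun=> x), (fun=> zeta).
split=> [||| _]; [exact: cvg_cst|exact: cvg_cst|exact: cvg_cst|].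
split=> //; rewrite limf_einfE; apply: le_trans (ereal_sup_ubound _); last first.
  by exists setT => //; exact: filterT.
apply: le_ereal_inf_tmp => _ [z _ <-].
apply: mule_ge0; last by rewrite lee_fin invr_ge0 sqrtr_ge0.
rewrite hx; case hz : (h z) => [b| |]; last by have := hNy z; rewrite hz.
  by rewrite -!EFinB lee_fin; have := sz z b; rewrite hz lexx => /(_ isT); lra.
exact: leey.
Qed.

Lemma KL_desing_half (c s : R) : 0 < s ->
  (KL_desing c 2^-1)^`()%classic s = c / 2 / Num.sqrt s.
Proof.
move=> s0; rewrite derive1E.
have -> : (KL_desing c 2^-1) = c \*: (fun s => s `^ (1 - 2^-1)) by [].
rewrite deriveZ; last first.
  by have := is_derive1_powR (1 - 2^-1) s0; case.
have := is_derive1_powR (1 - 2^-1) s0; case=> _ ->.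
have -> : 1 - 2^-1 = 2^-1 :> R by lra.
have -> : 2^-1 - 1 = - 2^-1 :> R by lra.
by rewrite powRN powR12_sqrt ?ltW// /GRing.scale /= mulrA.
Qed.

(* A subgradient [zeta] at [x] and a point [y] of the sublevel set
   [h <= h xbar] satisfy [h x - h xbar <= <zeta, x - y>]. *)
Lemma KL_half_of_growth h x0 (a : R) : proper_fun h -> lower_semicontinuous h ->
    convex_epi h -> dom_subdiff h x0 -> h x0 = a%:E ->
    (exists r c : R, exists V : set 'rV[R]_n,
      [/\ 0 < r, 0 < c, nbhs x0 V &
      forall x e, V x -> h x = (a + e)%:E -> 0 < e < r ->
        exists2 y, (h y <= a%:E)%E & dotv (x - y) (x - y) <= c * e]) ->
  KL_property h x0 2^-1.
Proof.
move=> hp hl hc hd hx0 [r [c [V [r0 c0 xV growth]]]]; split=> //; first lra.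
have [hNy _] := hp.
have C0 : 0 < 2 * Num.sqrt c by rewrite mulr_gt0 ?sqrtr_gt0.
(* With this constant the derivative of the desingularizing function at e is sqrt (c / e), matching
   e <= |zeta| sqrt (c e). *)
exists r%:E, V, (2 * Num.sqrt c); split=> // x Vx; rewrite hx0 => ax xa.
have [b hx] : exists b, h x = b%:E.
  by apply: ereal_finE => //; rewrite (lt_trans xa)// ltry.
rewrite hx lte_fin in ax; rewrite hx lte_fin in xa.
rewrite hx -EFinB /= KL_desing_half; last by lra.
set e := b - a; have e0 : 0 < e by rewrite /e; lra.
have [y hy xy] : exists2 y, (h y <= a%:E)%E & dotv (x - y) (x - y) <= c * e.
  apply: (growth x e) => //; first by rewrite hx /e subrKC.
  by rewrite e0 /e; lra.
set k := _ / _ / _; have k0 : 0 < k by rewrite !divr_gt0 ?sqrtr_gt0.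
have -> : 1%E = (k%:E * (k^-1)%:E)%E :> \bar R.
  by rewrite -EFinM divff ?gt_eqF.
apply: lee_wpmul2l; first by rewrite lee_fin ltW.
apply: le_ereal_inf_tmp => _ [zeta hz <-]; rewrite lee_fin sub0r.
have := subdiff_subgrad hNy hc hx hz hy.
have -> : dotv zeta (y - x) = - dotv zeta (x - y) by rewrite -dotvNr opprB.
move=> ez; have {}ez : e <= dotv zeta (x - y) by rewrite /e; lra.
have CS := dotv_CS zeta (x - y).
have ce : 1 <= c * dotv zeta zeta / e.
  rewrite ler_pdivlMr// mul1r -(ler_pM2l e0).
  have := dotv_ge0 zeta; have : e * e <= dotv zeta (x - y) ^+ 2.
    by rewrite expr2 ler_pM// ltW.
  nra.
rewrite -div1r ler_pdivrMr//.
have -> : enorm (- zeta) * k = Num.sqrt (c * dotv zeta zeta / e).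
  rewrite /enorm dotvNl dotvNr opprK /k sqrtrM ?mulr_ge0 ?dotv_ge0 ?ltW//.
  rewrite sqrtrM ?ltW// sqrtrV ?ltW//.
  by field; rewrite gt_eqF// sqrtr_gt0.
by rewrite -[leLHS]sqrtr1 ler_wsqrtr.
Qed.

End ConvexAnalysis.

(** * Sums of extended-valued functions *)

Section Sums.
Context {R : realType} {n : nat}.

Lemma ereal_ltD_split (u v : \bar R) (a : R) : u != -oo%E -> v != -oo%E ->
  (a%:E < u + v)%E -> exists b c, [/\ (b%:E < u)%E, (c%:E < v)%E & a = b + c].
Proof.
case: u => [u| |] //; case: v => [v| |] // _ _.
- rewrite -EFinD lte_fin => auv; exists (u - (u + v - a) / 2).
  by exists (v - (u + v - a) / 2); rewrite !lte_fin; split; lra.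
- by move=> _; exists (u - 1), (a - (u - 1)); rewrite !lte_fin !ltry; split=> //; lra.
- by move=> _; exists (a - (v - 1)), (v - 1); rewrite !lte_fin !ltry; split=> //; lra.
- by move=> _; exists a, 0; rewrite !ltry addr0.
Qed.

Lemma lsc_add (f g : 'rV[R]_n -> \bar R) :
  (forall x, f x != -oo%E) -> (forall x, g x != -oo%E) ->
  lower_semicontinuous f -> lower_semicontinuous g ->
  lower_semicontinuous (fun x => f x + g x)%E.
Proof.
move=> fN gN lf lg x a /(ereal_ltD_split (fN x) (gN x))[b [c [bf cg ->]]].
have [V xV Vf] := lf x b bf; have [W xW Wg] := lg x c cg.
exists (V `&` W); first exact: filterI.
by move=> y [/Vf yf /Wg yg]; rewrite EFinD lteD.
Qed.

Lemma lsc_sum m (f : 'I_m -> 'rV[R]_n -> \bar R) :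
  (forall i x, f i x != -oo%E) -> (forall i, lower_semicontinuous (f i)) ->
  lower_semicontinuous (sum_fun f).
Proof.
move=> fN lf; rewrite /sum_fun.
elim: (index_enum _) => [|i r IH] x a.
  by rewrite big_nil => a0; exists setT => [|y _]; [exact: filterT|rewrite big_nil].
rewrite big_cons => ax.
have sN y : (\sum_(j <- r) f j y != -oo)%E.
  by apply/eqP => /esum_eqNyP[j [_ _ /eqP]]; apply/negP.
have [V xV Vy] := @lsc_add (f i) _ (fN i) sN (lf i) IH x a ax.
by exists V => // y /Vy; rewrite big_cons.
Qed.

Lemma sum_fun_ltyP m (f : 'I_m -> 'rV[R]_n -> \bar R) x :
  (forall i x, f i x != -oo%E) -> (sum_fun f x < +oo)%E ->
  forall i, exists t, f i x = t%:E.
Proof.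
move=> fN fx i; apply: ereal_finE => //; rewrite ltey; apply/eqP => fi.
move: fx; rewrite ltey => /eqP; apply; apply/eqP.
by rewrite esum_eqy //; apply/existsP; exists i; rewrite /= fi.
Qed.

Lemma sum_fun_le m (f : 'I_m -> 'rV[R]_n -> \bar R) x (t : 'I_m -> R) :
  (forall i, (f i x <= (t i)%:E)%E) -> (sum_fun f x <= (\sum_i t i)%:E)%E.
Proof. by move=> ft; rewrite -sumEFin; apply: lee_sum. Qed.

Lemma sum_funE m (f : 'I_m -> 'rV[R]_n -> \bar R) x (t : 'I_m -> R) :
  (forall i, f i x = (t i)%:E) -> sum_fun f x = (\sum_i t i)%:E.
Proof. by move=> ft; rewrite -sumEFin; apply: eq_bigr. Qed.

Lemma sum_fun_leP m (f : 'I_m -> 'rV[R]_n -> \bar R) x (a : R) :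
  (forall i x, f i x != -oo%E) -> (sum_fun f x <= a%:E)%E ->
  exists2 t : 'I_m -> R, forall i, f i x = (t i)%:E & \sum_i t i <= a.
Proof.
move=> fN fa; have /sum_fun_ltyP ft : (sum_fun f x < +oo)%E.
  by rewrite (le_lt_trans fa)// ltry.
exists (fun i => fine (f i x)); first by move=> i; have [t ->] := ft fN i.
by rewrite -lee_fin -(@sum_funE _ f x)// => i; have [t ->] := ft fN i.
Qed.

Lemma convex_sum m (f : 'I_m -> 'rV[R]_n -> \bar R) :
  (forall i x, f i x != -oo%E) -> (forall i, convex_epi (f i)) ->
  convex_epi (sum_fun f).
Proof.
move=> fN cf x y t s e e01 /(sum_fun_leP fN)[a fa at_] /(sum_fun_leP fN)[b fb bs].
have H i : (f i (x + e *: (y - x))%R <= (a i + e * (b i - a i))%:E)%E.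
  by apply: cf => //; rewrite ?fa ?fb.
apply: (le_trans (sum_fun_le H)); rewrite lee_fin big_split /= -mulr_sumr.
rewrite sumrB; case/andP: e01; nra.
Qed.

Lemma subgrad_sum m (f : 'I_m -> 'rV[R]_n -> \bar R) x (a : 'I_m -> R)
    (zeta : 'I_m -> 'rV[R]_n) : (forall i x, f i x != -oo%E) ->
  (forall i, subgrad (f i) x (a i) (zeta i)) ->
  subgrad (sum_fun f) x (\sum_i a i) (\sum_i zeta i).
Proof.
move=> fN sz y t /(sum_fun_leP fN)[b fb bt]; apply: le_trans bt.
rewrite dotv_suml -big_split /=; apply: ler_sum => i _.
by apply: sz; rewrite fb.
Qed.

(* Lower semicontinuity bounds every summand below; as the sum is close to its
   value at [x0], every summand is then also bounded above. *)
Lemma sum_fun_summands_near m (f : 'I_m -> 'rV[R]_n -> \bar R) x0 (a : 'I_m -> R)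
    (k : R) : (forall i, lower_semicontinuous (f i)) ->
    (forall i, f i x0 = (a i)%:E) -> 0 < k ->
  exists2 r, 0 < r & \forall x \near x0, forall b : 'I_m -> R,
    (forall i, f i x = (b i)%:E) -> \sum_i b i <= \sum_i a i + r ->
    forall i, `|b i - a i| <= k.
Proof.
(* Each [b j - a j + r] is nonnegative and together they sum to at most [r * m.+1%:R], so each is at
   most [k]. *)
move=> lf fa k0; pose r := k / m.+1%:R; have r0 : 0 < r by rewrite divr_gt0.
have kr : k = r * m.+1%:R by rewrite divfK ?gt_eqF.
exists r => //.
have low : \forall x \near x0, forall i, ((a i - r)%:E < f i x)%E.
  apply: (@filter_forall _ _ (fun i x => ((a i - r)%:E < f i x)%E) (nbhs x0)) => i.
  have [|V xV Vf] := lf i x0 (a i - r).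
    by rewrite fa lte_fin; lra.
  exact: filterS xV.
apply: filterS low => x low b fb ba i.
have low' j : 0 <= b j - a j + r.
  by have := low j; rewrite fb lte_fin; lra.
have up : b i - a i + r <= r * m.+1%:R.
  rewrite -nat1r mulrDr mulr1.
  have : \sum_j (b j - a j + r) <= r + r * m%:R.
    rewrite big_split /= sumrB sumr_const card_ord mulr_natr; lra.
  have : 0 <= \sum_(j | j != i) (b j - a j + r) by apply: sumr_ge0.
  by rewrite [in X in _ -> X](bigD1 i)//=; lra.
have rk : r <= k by rewrite kr ler_peMr ?(ltW r0)// ler1n.
by rewrite ler_norml; have := low' i; rewrite -kr in up; lra.
Qed.

End Sums.

(** * Linear matrix inequalities *)

Section BlockDiagonal.
Context {R : realType} {m : nat} {d : 'I_m -> nat}.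
Implicit Types B : forall i, 'M[R]_(d i).

Lemma qf_mxdiag B u v :
  qf (\mxdiag_i B i) u v = \sum_i qf (B i) (submxrow u i) (submxrow v i).
Proof.
rewrite /qf -{1}(submxrowK u) mul_mxrow_mxdiag -{1}(submxrowK v) tr_mxrow.
by rewrite mul_mxrow_mxcol summxE.
Qed.

Lemma mxdiag_mulmx_eq0 B (u : 'rV[R]_(\sum_i d i)) :
  u *m \mxdiag_i B i = 0 <-> forall i, submxrow u i *m B i = 0.
Proof.
rewrite -{1}(submxrowK u) mul_mxrow_mxdiag.
have -> : (0 : 'M[R]_(1, \sum_i d i)) = \mxrow_i (0 : 'M[R]_(1, d i)).
  by rewrite mxrow0.
by rewrite -eq_mxrowP.
Qed.

Definition embed_row i (v : 'rV[R]_(d i)) : 'rV[R]_(\sum_j d j) :=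
  \mxrow_j (if i == j then conform_mx 0 v else 0).

Lemma embed_rowK i (v : 'rV[R]_(d i)) : submxrow (embed_row v) i = v.
Proof. by rewrite /embed_row mxrowK eqxx conform_mx_id. Qed.

Lemma embed_row0 i j (v : 'rV[R]_(d i)) : i != j -> submxrow (embed_row v) j = 0.
Proof. by move=> /negPf ij; rewrite /embed_row mxrowK ij. Qed.

Lemma qf_mxdiag_embed B i v :
  qf (\mxdiag_j B j) (embed_row v) (embed_row v) = qf (B i) v v.
Proof.
rewrite qf_mxdiag (bigD1 i)//= embed_rowK big1 ?addr0// => j ji.
by rewrite embed_row0 1?eq_sym// qfE mul0mx dotv0l.
Qed.

Lemma psd_mxdiag B : psd (\mxdiag_i B i) <-> forall i, psd (B i).
Proof.
split=> [pB i v|pB u]; first by rewrite -qf_mxdiag_embed.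
by rewrite qf_mxdiag; apply: sumr_ge0 => i _; exact: pB.
Qed.

Lemma mxdiag_nonneg_on B (Y : forall i, 'M[R]_(d i)) :
  (forall u, u *m \mxdiag_i Y i = 0 -> 0 <= qf (\mxdiag_i B i) u u) ->
  forall i v, v *m Y i = 0 -> 0 <= qf (B i) v v.
Proof.
move=> pB i v vY; rewrite -qf_mxdiag_embed; apply: pB.
apply/mxdiag_mulmx_eq0 => j; have [<-|ij] := eqVneq i j.
  by rewrite embed_rowK.
by rewrite embed_row0// mul0mx.
Qed.

Lemma lincomb_mxdiag N (H : forall i, 'I_N -> 'M[R]_(d i)) w :
  lincomb (fun k => \mxdiag_i H i k) w = \mxdiag_i lincomb (H i) w.
Proof.
have scale_mxdiag a B : a *: \mxdiag_i B i = \mxdiag_i (a *: B i).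
  rewrite -mul_scalar_mx -mxdiagZ mul_mxdiag_mxblock; apply/eq_mxblockP => i j.
  rewrite mul_scalar_mx; case: (eqVneq i j) => [ij|_]; last by rewrite scaler0.
  by case: _ / ij; rewrite !conform_mx_id.
rewrite /lincomb mxdiag_sum; apply: eq_bigr => k _.
exact: scale_mxdiag.
Qed.

End BlockDiagonal.

(** * A single LMI-representable function *)

Section LMI.
Context {R : realType} {n d : nat} (A00 A0 : 'M[R]_d) (A : 'I_n -> 'M[R]_d).
Implicit Types (h : 'rV[R]_n -> \bar R) (x u : 'rV[R]_n) (t s : R).

Definition lmi_dir u s : 'M[R]_d := lincomb A u + s *: A0.

Lemma lmi_pencilD x t u s : lmi_pencil A00 A0 A (x + u) (t + s) =
  lmi_pencil A00 A0 A x t + lmi_dir u s.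
Proof.
rewrite /lmi_pencil -!/(lincomb A _) /lmi_dir lincombD scalerDl.
by rewrite [RHS]addrACA !addrA.
Qed.

Lemma lmi_pencilB x t y s : lmi_pencil A00 A0 A y s =
  lmi_pencil A00 A0 A x t + lmi_dir (y - x) (s - t).
Proof. by rewrite -lmi_pencilD !subrKC. Qed.

Lemma lmi_dirZ a u s : lmi_dir (a *: u) (a * s) = a *: lmi_dir u s.
Proof. by rewrite /lmi_dir lincombZ scalerDr scalerA. Qed.

Lemma lmi_dir0 s : lmi_dir 0 s = s *: A0.
Proof. by rewrite /lmi_dir -(scale0r 0) lincombZ scale0r add0r. Qed.

Context {h : 'rV[R]_n -> \bar R} (rep : lmi_represents A00 A0 A h).

Lemma trmx_lmi_dir u s : (lmi_dir u s)^T = lmi_dir u s.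
Proof.
case: rep => _ _ /symmxP s0 sA _; rewrite linearD linearZ /= s0.
by rewrite trmx_lincomb// => k; apply/symmxP.
Qed.

Lemma trmx_lmi_pencil x t : (lmi_pencil A00 A0 A x t)^T = lmi_pencil A00 A0 A x t.
Proof.
case: rep => _ /symmxP s00 _ _ _.
have -> : lmi_pencil A00 A0 A x t = A00 + lmi_dir x t by rewrite /lmi_dir addrA.
by rewrite linearD /= s00 trmx_lmi_dir.
Qed.

Lemma lmi_leP x t : (h x <= t%:E)%E <-> psd (lmi_pencil A00 A0 A x t).
Proof.
case: (rep) => _ _ _ _ /seteqP[e1 e2]; split=> [xt|p].
  by have /psdmxP[] := e1 (x, t) xt.
by apply: (e2 (x, t)); apply/psdmxP; split=> //=; exact: trmx_lmi_pencil.
Qed.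

Lemma lmi_convex : convex_epi h.
Proof.
move=> x y t s e /andP[e0 e1] /lmi_leP px /lmi_leP py; apply/lmi_leP => u.
rewrite lmi_pencilD -[X in lmi_dir _ X]/(e * (s - t)) lmi_dirZ qf_mxD qf_mxZ.
have := py u; rewrite (lmi_pencilB x t) qf_mxD; have := px u.
nra.
Qed.

(** The epigraph contains the upward ray from [(x, a)], so the form of [A0] cannot be negative. *)
Lemma lmi_slope_psd x a : h x = a%:E -> psd A0.
Proof.
move=> hx u; rewrite leNgt; apply/negP => q0.
have Y0 : psd (lmi_pencil A00 A0 A x a) by apply/lmi_leP; rewrite hx.
(* At height [a + t] the form at [u] would equal -1. *)
pose t := (qf (lmi_pencil A00 A0 A x a) u u + 1) / - qf A0 u u.
have t0 : 0 <= t by rewrite divr_ge0// ?oppr_ge0 ?ltW// ltr_wpDl.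
have : psd (lmi_pencil A00 A0 A (x + 0) (a + t)).
  by apply/lmi_leP; rewrite addr0 hx lee_fin lerDl.
move=> /(_ u); rewrite lmi_pencilD qf_mxD lmi_dir0 qf_mxZ.
have -> : t * qf A0 u u = - (qf (lmi_pencil A00 A0 A x a) u u + 1).
  by rewrite /t; field; rewrite lt_eqF.
by move: (qf _ _ _) => q; lra.
Qed.

(* If [A0] vanished on the kernel of the pencil at [(x, h x)], the point
   [(x, h x - s)] would still satisfy the inequality for small [s > 0]. *)
Lemma lmi_slope_gt0 x a (K : 'M[R]_d) : h x = a%:E ->
  (forall u : 'rV[R]_d, u *m lmi_pencil A00 A0 A x a = 0 -> exists v, u = v *m K) ->
  0 < \tr (K *m A0 *m K^T).
Proof.
move=> hx KP; have p0 := lmi_slope_psd hx.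
have s0 : A0^T = A0 by case: rep => _ _ /symmxP.
have t0 : 0 <= \tr (K *m A0 *m K^T).
  by apply: psd_tr_ge0 => u; rewrite qf_congr.
rewrite lt_def t0 andbT; apply/eqP => tr0.
have KA : K *m A0 = 0.
  apply: fro2_eq0; apply/eqP; rewrite eq_le fro2_ge0 andbT.
  by rewrite (le_trans (psd_mulmx_le K s0 p0))// tr0 mul0r.
have pY : psd (lmi_pencil A00 A0 A x a) by apply/lmi_leP; rewrite hx.
have [r r0 rP] := psd_perturb (trmx_lmi_pencil x a) pY.
have F0 : 0 < fro2 A0 + 1 by rewrite ltr_wpDl ?fro2_ge0.
(* This makes the squared norm of [s *: A0] at most [r]. *)
pose s := Num.sqrt (r / (fro2 A0 + 1)).
have sp : 0 < s by rewrite sqrtr_gt0 divr_gt0.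
have : psd (lmi_pencil A00 A0 A x a + lmi_dir 0 (- s)).
  apply: rP; first exact: trmx_lmi_dir.
    have -> : fro2 (lmi_dir 0 (- s)) = s ^+ 2 * fro2 A0.
      rewrite lmi_dir0 /fro2 mulr_sumr; apply: eq_bigr => i _.
      by rewrite mulr_sumr; apply: eq_bigr => j _; rewrite mxE exprMn sqrrN.
    rewrite sqr_sqrtr ?(ltW (divr_gt0 r0 F0))// mulrAC ler_pdivrMr//.
    by rewrite ler_wpM2l ?(ltW r0)// lerDl.
  by move=> u /KP[v ->]; rewrite lmi_dir0 -scalemxAr -mulmxA KA mulmx0 scaler0.
rewrite -lmi_pencilD => /lmi_leP; rewrite addr0 hx lee_fin; lra.
Qed.

(** The multiplier [K^T *m K], which charges the whole kernel, yields a subgradient [zeta] with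
    strict complementarity: the trace of a compressed direction is [c * (s - dotv zeta u)]. If the
    direction is nonnegative on the kernel this trace is nonnegative, and it is zero only if the
    compression vanishes. *)
Lemma lmi_subgrad x a : h x = a%:E -> exists zeta, subgrad h x a zeta /\
  forall u s,
    (forall v, v *m lmi_pencil A00 A0 A x a = 0 -> 0 <= qf (lmi_dir u s) v v) ->
    dotv zeta u <= s /\ (dotv zeta u = s ->
      forall v, v *m lmi_pencil A00 A0 A x a = 0 -> qf (lmi_dir u s) v v = 0).
Proof.
move=> hx; have [K KY KP] := ker_basis (lmi_pencil A00 A0 A x a).
set c := \tr (K *m A0 *m K^T); have c0 : 0 < c := lmi_slope_gt0 hx KP.
pose zeta := \row_j (- (\tr (K *m A j *m K^T) / c)).
have trE u s : \tr (K *m lmi_dir u s *m K^T) = c * (s - dotv zeta u).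
  have trA : \tr (K *m lincomb A u *m K^T) = - (c * dotv zeta u).
    rewrite -lincomb_mul tr_lincomb /dotv mulr_sumr -sumrN.
    by apply: eq_bigr => j _; rewrite !mxE; field; rewrite gt_eqF.
  rewrite /lmi_dir mulmxDr mulmxDl mxtraceD trA -scalemxAr -scalemxAl.
  by rewrite mxtraceZ -/c; ring.
have key u s :
    (forall v, v *m lmi_pencil A00 A0 A x a = 0 -> 0 <= qf (lmi_dir u s) v v) ->
    dotv zeta u <= s /\ (dotv zeta u = s ->
      forall v, v *m lmi_pencil A00 A0 A x a = 0 -> qf (lmi_dir u s) v v = 0).
  move=> pos; have pK : psd (K *m lmi_dir u s *m K^T).
    by move=> v; rewrite qf_congr; apply: pos; rewrite -mulmxA KY mulmx0.
  split=> [|us v /KP[w ->]].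
    by have := psd_tr_ge0 pK; rewrite trE pmulr_rge0// subr_ge0.
  rewrite -qf_congr (psd_tr0 _ pK); first by rewrite qfE mulmx0 dotv0l.
    by rewrite !trmx_mul trmxK trmx_lmi_dir mulmxA.
  by rewrite trE us subrr mulr0.
exists zeta; split=> // y t /lmi_leP; rewrite (lmi_pencilB x a) => py.
have [|+ _] := key (y - x) (t - a); last by lra.
move=> v vY; have := py v.
by rewrite qf_mxD [X in X + _]qfE vY dotv0l add0r.
Qed.

End LMI.

(** * Consequences of Slater's condition and of the relative interior *)

Section SlaterPoint.
Context {R : realType}.

Lemma pdmx_ker d (M : 'M[R]_d) (v : 'rV[R]_d) : pdmx M -> v *m M = 0 -> v = 0.
Proof.
move=> [_ pM] vM; apply/eqP; apply: contraT => v0.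
have := pM v^T; rewrite trmx_eq0 v0 => /(_ isT).
by rewrite trmxK vM mul0mx mxE ltxx.
Qed.

Lemma pdmx_psd d (M : 'M[R]_d) : pdmx M -> M^T = M /\ psd M.
Proof.
move=> [sM pM]; split=> [|u]; first exact/symmxP.
have [->|u0] := eqVneq u 0; first by rewrite qfE mul0mx dotv0l.
by have := pM u^T; rewrite trmx_eq0 u0 trmxK => /(_ isT)/ltW.
Qed.

Lemma pd_mxdiag_coercive m (d : 'I_m -> nat) (M : forall i, 'M[R]_(d i)) :
  (forall i, pdmx (M i)) ->
  exists2 k, 0 < k & forall u, k * dotv u u <= qf (\mxdiag_i M i) u u.
Proof.
move=> pM; have sM : (\mxdiag_i M i)^T = \mxdiag_i M i.
  by rewrite tr_mxdiag; apply: eq_mxdiag => i; case: (pdmx_psd (pM i)).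
have [|k k0 kM] := psd_coercive sM.
  by apply/psd_mxdiag => i; case: (pdmx_psd (pM i)).
exists k => // u; have [v /mxdiag_mulmx_eq0 vM] := kM u.
suff -> : v = 0 by rewrite subr0.
rewrite -(submxrowK v) -(mxrow0 (q_ := d)); apply: eq_mxrow => i.
exact: pdmx_ker (pM i) (vM i).
Qed.

(* The perturbation towards a Slater point turns a direction that is merely
   nonnegative on the kernel of [X] into a feasible one. *)
Lemma subgrad_le_slope n m d (X : 'M[R]_d) (H : 'I_(n + m) -> 'M[R]_d)
    (h : 'rV[R]_n -> \bar R) x a zeta (s ws : 'rV[R]_(n + m)) :
    X^T = X -> psd X -> (forall k, (H k)^T = H k) ->
    (forall w, psd (X + lincomb H w) ->
       (h (x + lsubmx w)%R <= (a + dotv s w)%:E)%E) ->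
    (exists2 k, 0 < k & forall u, k * dotv u u <= qf (X + lincomb H ws) u u) ->
    subgrad h x a zeta ->
  forall w, (forall u, u *m X = 0 -> 0 <= qf (lincomb H w) u u) ->
    dotv zeta (lsubmx w) <= dotv s w.
Proof.
move=> sX pX sH feas [k k0 kP] sz w wP.
(* On the kernel of [X] the direction [w + e *: ws] is coercive with constant [e * k], so a short
   step along it is feasible. *)
have step e : 0 < e ->
    dotv zeta (lsubmx w) - dotv s w <= e * (dotv s ws - dotv zeta (lsubmx ws)).
  move=> e0; have [|||t t0] := @psd_move _ _ X (lincomb H (w + e *: ws)) (e * k) sX pX.
  - exact: trmx_lincomb.
  - exact: mulr_gt0.
  - move=> u uX; rewrite lincombD lincombZ qf_mxD qf_mxZ.
    have := kP u; rewrite qf_mxD [X in X + _]qfE uX dotv0l add0r.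
    by have := wP u uX; nra.
  rewrite -lincombZ => /feas/sz; rewrite [x + _]addrC addrK.
  have -> : lsubmx (t *: (w + e *: ws)) = t *: (lsubmx w + e *: lsubmx ws).
    by rewrite linearZ /= linearD /= linearZ.
  rewrite !(dotvZr, dotvDr) lerD2l ler_pM2l//; lra.
rewrite -subr_le0 leNgt; apply/negP.
set p := _ - _ in step *; set q := _ - _ in step => p0.
have q0 : 0 < `|q| + 1 by rewrite ltr_wpDl.
have p2 : 0 < p / 2 by rewrite divr_gt0.
(* For this [e] the right side is at most half of [p] in absolute value, contradicting [p > 0]. *)
have := step (p / 2 / (`|q| + 1)) (divr_gt0 p2 q0).
rewrite mulrAC ler_pdivlMr//; have := ler_norm q; nra.
Qed.

Lemma dotv_row_mx n m (u1 v1 : 'rV[R]_n) (u2 v2 : 'rV[R]_m) :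
  dotv (row_mx u1 u2) (row_mx v1 v2) = dotv u1 v1 + dotv u2 v2.
Proof.
rewrite /dotv big_split_ord /=; congr (_ + _); apply: eq_bigr => i _.
  by rewrite !row_mxEl.
by rewrite !row_mxEr.
Qed.

Lemma dotv_lsubmx_le n m (w : 'rV[R]_(n + m)) :
  dotv (lsubmx w) (lsubmx w) <= dotv w w.
Proof. by rewrite -[in leRHS](hsubmxK w) dotv_row_mx lerDl dotv_ge0. Qed.

Lemma near_dotv_le n (x : 'rV[R]_n) r : 0 < r ->
  \forall y \near x, dotv (y - x) (y - x) <= r.
Proof.
move=> r0; have cx : (y - x) @[y --> x] --> (0 : 'rV[R]_n).
  rewrite -(subrr x); apply: (@cvgB _ _ _ (nbhs x) _ id (fun=> x)).
    exact: cvg_id.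
  exact: cvg_cst.
have := @cvg_dotv _ _ (nbhs x) _ (fun y => y - x) (fun y => y - x) 0 0 _ cx cx.
by rewrite dotv0l => c0; exact: (cvgr_le _ (c0 _)).
Qed.

(** The line through 0 and [zeta] lies in the affine hull, so a short step from 0 away from [zeta]
    stays in [C]. *)
Lemma relint0_opp n (C : set 'rV[R]_n) zeta : relint C 0 -> C zeta ->
  exists2 e, 0 < e & C (- e *: zeta).
Proof.
move=> [C0 /nbhs_normP[r r0 rC]] Cz; move: r0 => /= r0.
have z0 : 0 < 2 * (`|zeta| + 1) by rewrite mulr_gt0// ltr_wpDl.
exists (r / (2 * (`|zeta| + 1))); first exact: divr_gt0.
set e := r / _; have e0 : 0 < e by exact: divr_gt0.
have er : e * (2 * (`|zeta| + 1)) = r by rewrite /e divfK// gt_eqF.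
apply: rC.
  rewrite /ball_ /= sub0r normrN normrZ normrN gtr0_norm//.
  have : 0 <= e * `|zeta| by rewrite mulr_ge0// ltW.
  lra.
move=> M [affM CM]; have := affM 0 zeta (- e) (CM _ C0) (CM _ Cz).
by rewrite scaler0 add0r.
Qed.

End SlaterPoint.

(** * From the block-diagonal pencil to growth of the sum *)

Unset Implicit Arguments.

Theorem theorem4p2 (R : realType) (n m : nat)
    (f : 'I_m -> 'rV[R]_n -> \bar R) (d : 'I_m -> nat)
    (A00 A0 : forall i : 'I_m, 'M[R]_(d i))
    (A : forall i : 'I_m, 'I_n -> 'M[R]_(d i))
    (xs : 'rV[R]_n) (ss : 'I_m -> R) (xbar : 'rV[R]_n)
    (f_proper : forall i, proper_fun (f i))
    (f_closed : forall i, lower_semicontinuous (f i))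
    (f_lmi : forall i, lmi_represents (A00 i) (A0 i) (A i) (f i))
    (slater : forall i, pdmx (lmi_pencil (A00 i) (A0 i) (A i) xs (ss i)))
    (xbar_dom : dom_subdiff (sum_fun f) xbar)
    (xbar_ri : relint (subdiff (sum_fun f) xbar) 0) :
  KL_property (sum_fun f) xbar 2^-1.
Proof.
have fN i x : f i x != -oo%E by case: (f_proper i).
have sN x : sum_fun f x != -oo%E.
  by apply/eqP => /esum_eqNyP[j [_ _ /eqP]]; apply/negP.
have xdom : (sum_fun f xbar < +oo)%E by case: xbar_dom => z [].
(* [w] below is the displacement of [(x, t_1, ..., t_m)] from
   [(xbar, f_1 xbar, ..., f_m xbar)]. *)
pose a i := fine (f i xbar).
have fa i : f i xbar = (a i)%:E.
  by rewrite /a; have [t ->] := sum_fun_ltyP fN xdom i.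
have Fa := sum_funE fa.
have Fc : convex_epi (sum_fun f) by apply: convex_sum => // i; exact: lmi_convex.
have F0 : subgrad (sum_fun f) xbar (\sum_i a i) 0.
  by case: xbar_ri => /(subdiff_subgrad sN Fc Fa).
pose Y i := lmi_pencil (A00 i) (A0 i) (A i) xbar (a i).
have sY i : (Y i)^T = Y i by exact: trmx_lmi_pencil.
have pY i : psd (Y i) by apply/(lmi_leP (f_lmi i)); rewrite fa.
pose X := \mxdiag_i Y i.
have sX : X^T = X by rewrite tr_mxdiag; exact: eq_mxdiag.
have pX : psd X by exact/psd_mxdiag.
(* The first [n] coordinates move x in every block; the coordinate of [t_i] acts on block [i]
   alone. *)
pose H i (k : 'I_(n + m)) : 'M[R]_(d i) :=
  match fintype.split k with inl j => A i j | inr i' => (i' == i)%:R *: A0 i end.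
pose L i w := lmi_dir (A0 i) (A i) (lsubmx w) (rsubmx w 0 i).
have HL i w : lincomb (H i) w = L i w.
  rewrite /lincomb big_split_ord /=; congr (_ + _).
    apply: eq_bigr => j _; rewrite /H (unsplitK (inl _ j)).
    by rewrite mxE.
  rewrite (bigD1 i)//= big1 ?addr0 => [|j /negPf ji].
    by rewrite /H (unsplitK (inr _ i)) eqxx scale1r mxE.
  by rewrite /H (unsplitK (inr _ j)) ji scale0r scaler0.
pose HH k := \mxdiag_i H i k.
have HHL w : lincomb HH w = \mxdiag_i L i w.
  by rewrite lincomb_mxdiag; apply: eq_mxdiag => i; rewrite HL.
have sHH k : (HH k)^T = HH k.
  rewrite tr_mxdiag; apply: eq_mxdiag => i; rewrite /H.
  case: (f_lmi i) => _ _ /symmxP s0 sA _.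
  by case: fintype.split => j; [exact/symmxP|rewrite linearZ /= s0].
pose s : 'rV[R]_(n + m) := row_mx 0 (const_mx 1).
have sE w : dotv s w = \sum_i rsubmx w 0 i.
  rewrite -[w in LHS]hsubmxK dotv_row_mx dotv0l add0r.
  by apply: eq_bigr => i _; rewrite mxE mul1r.
have feasP w : psd (X + lincomb HH w) <->
    forall i, (f i (xbar + lsubmx w)%R <= (a i + rsubmx w 0 i)%:E)%E.
  rewrite HHL -mxdiagD psd_mxdiag; split=> p i.
    by apply/(lmi_leP (f_lmi i)); rewrite lmi_pencilD; exact: p.
  by have /(lmi_leP (f_lmi i)) := p i; rewrite lmi_pencilD.
have feasF w : psd (X + lincomb HH w) ->
    (sum_fun f (xbar + lsubmx w)%R <= (\sum_i a i + dotv s w)%:E)%E.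
  by move=> /feasP/sum_fun_le; rewrite big_split /= -sE.
pose ws : 'rV[R]_(n + m) := row_mx (xs - xbar) (\row_i (ss i - a i)).
have ws_pd : exists2 k, 0 < k &
    forall u, k * dotv u u <= qf (X + lincomb HH ws) u u.
  have [k k0 kP] := pd_mxdiag_coercive slater; exists k => // u.
  have -> // : X + lincomb HH ws =
      \mxdiag_i lmi_pencil (A00 i) (A0 i) (A i) xs (ss i).
  rewrite HHL -mxdiagD; apply: eq_mxdiag => i.
  by rewrite -lmi_pencilD /ws row_mxKl row_mxKr mxE !subrKC.
have slope zeta := subgrad_le_slope (zeta := zeta) sX pX sHH feasF ws_pd.
have /choice[zeta zetaP] i := lmi_subgrad (f_lmi i) (fa i).
have Fz : subgrad (sum_fun f) xbar (\sum_i a i) (\sum_i zeta i).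
  by apply: subgrad_sum => // i; case: (zetaP i).
(* Only here is 0 used as a relative interior point: a negative multiple of the special subgradient
   is again a subgradient. *)
have [e e0 Fze] : exists2 e, 0 < e &
    subgrad (sum_fun f) xbar (\sum_i a i) (- e *: \sum_i zeta i).
  have [e e0 ze] := relint0_opp xbar_ri (subgrad_subdiff sN Fa Fz).
  by exists e => //; exact: subdiff_subgrad ze.
have [|r [c [r0 c0 growth]]] := @quadratic_growth _ _ _ X HH s sX pX sHH.
  move=> w wP; have sw0 : 0 <= dotv s w.
    by have := slope 0 F0 w wP; rewrite dotv0l.
  split=> // sw u uX.
  (* The subgradients of opposite sign give the two inequalities. *)
  have zw : dotv (\sum_i zeta i) (lsubmx w) = 0.
    have := slope _ Fze w wP; rewrite dotvZl sw mulNr oppr_le0 pmulr_rge0// => z1.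
    by apply/eqP; rewrite eq_le z1 andbT -sw slope.
  have zi i : dotv (zeta i) (lsubmx w) <= rsubmx w 0 i /\
      (dotv (zeta i) (lsubmx w) = rsubmx w 0 i ->
        forall v, v *m Y i = 0 -> qf (L i w) v v = 0).
    case: (zetaP i) => _; apply; apply: (@mxdiag_nonneg_on _ _ _ (L^~ w) Y).
    by rewrite -HHL.
  (* The gaps are nonnegative and sum to zero, so strict complementarity applies in every block. *)
  have zeq i : dotv (zeta i) (lsubmx w) = rsubmx w 0 i.
    have gap j : 0 <= rsubmx w 0 j - dotv (zeta j) (lsubmx w).
      by rewrite subr_ge0; case: (zi j).
    have sum0 : \sum_j (rsubmx w 0 j - dotv (zeta j) (lsubmx w)) = 0.
      by rewrite sumrB -sE sw -dotv_suml zw subr0.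
    have /psumr_eq0P/(_ sum0 i isT)/eqP : forall j, true ->
        0 <= rsubmx w 0 j - dotv (zeta j) (lsubmx w) by move=> j _.
    by rewrite subr_eq0 => /eqP.
  rewrite HHL qf_mxdiag; apply: big1 => i _.
  by case: (zi i) => _; apply => //; move/mxdiag_mulmx_eq0: uX.
(* The displacements of the [t_i] then contribute at most [r / 2] to |w|^2; [m.+1] avoids dividing
   by zero when [m = 0]. *)
pose k := Num.sqrt (r / 2 / m.+1%:R).
have k0 : 0 < k by rewrite sqrtr_gt0 !divr_gt0.
have [q q0 qP] := sum_fun_summands_near f_closed fa k0.
apply: (KL_half_of_growth _ _ Fc xbar_dom Fa).
- by split=> //; exists xbar.
- exact: lsc_sum.
have r2 : 0 < r / 2 by rewrite divr_gt0.
exists (Num.min q r), c, [set x | dotv (x - xbar) (x - xbar) <= r / 2 /\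
  forall b, (forall i, f i x = (b i)%:E) ->
    \sum_i b i <= \sum_i a i + q -> forall i, `|b i - a i| <= k].
split=> //; first by rewrite lt_min q0.
  by apply: filterI => //; exact: near_dotv_le.
move=> x t [xr xk] Fx /andP[t0]; rewrite lt_min => /andP[tq tr].
have [b fb bt] : exists2 b, (forall i, f i x = (b i)%:E) &
    \sum_i b i = \sum_i a i + t.
  have [|b fb _] := sum_fun_leP fN (x := x) (a := \sum_i a i + t).
    by rewrite Fx.
  by exists b => //; have := sum_funE fb; rewrite Fx => -[].
pose w : 'rV[R]_(n + m) := row_mx (x - xbar) (\row_i (b i - a i)).
have sw : dotv s w = t.
  rewrite sE /w row_mxKr; under eq_bigr do rewrite mxE.
  by rewrite sumrB bt addrC addKr.
have [|||w' [pw' sw' ww']] := growth w.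
- rewrite dotv_row_mx (splitr r) lerD//.
  have bk i : (b i - a i) * (b i - a i) <= r / 2 / m.+1%:R.
    have <- : k ^+ 2 = r / 2 / m.+1%:R by rewrite sqr_sqrtr// ltW// !divr_gt0.
    rewrite -expr2 -real_normK ?num_real// ler_sqr ?nnegrE ?(ltW k0)//.
    apply: xk => //.
    by rewrite bt lerD2l ltW.
  apply: (@le_trans _ _ (\sum_(i < m) r / 2 / m.+1%:R)).
    by apply: ler_sum => i _; rewrite !mxE.
  rewrite sumr_const card_ord -[leLHS]mulr_natr -mulrA ler_piMr ?(ltW r2)//.
  by rewrite mulrC ler_pdivrMr// mul1r ler_nat.
- by rewrite sw ltW.
- apply/feasP => i; rewrite /w row_mxKl row_mxKr mxE !subrKC fb.
  exact: lexx.
(* As [s] vanishes at [w'], its x-part leads to a point of value at most that at [xbar]. *)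
exists (xbar + lsubmx w').
  by have := feasF w' pw'; rewrite sw' addr0.
have -> : x - (xbar + lsubmx w') = lsubmx (w - w').
  by rewrite linearB /= row_mxKl opprD addrA.
by rewrite (le_trans (dotv_lsubmx_le _))// -sw.
Qed.
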